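(* Let $X$ be a first-countable $T_0$ space. The following conditions are equivalent: (1) $X$ is a sober space. (2) $X$ is a well-filtered space. (3) $X$ is an $\omega$-well-filtered $d$-space (i.e. both $\omega$-well-filtered and a $d$-space). (4) $X$ is an $\omega$-well-filtered $\omega^\ast$-$d$-space (i.e. both $\omega$-well-filtered and an $\omega^\ast$-$d$-space).
   Context: For a $T_0$ space $X$, the specialization order is $x\le y$ iff $x\in\overline{\{y\}}$; all order notions on $X$ refer to it. A subset is saturated if it is an upper set (equivalently, an intersection of open sets). $\mathsf{K}(X)$ is the set of all nonempty compact saturated subsets of $X$. A family $\mathcal K\subseteq\mathsf K(X)$ is filtered if it is nonempty and for all $K_1,K_2\in\mathcal K$ there is $K_3\in\mathcal K$ with $K_3\subseteq K_1\cap K_2$. A $T_0$ space $X$ is well-filtered if for every open $U$ and every filtered family $\mathcal K\subseteq\mathsf K(X)$, $\bigcap\mathcal K\subseteq U$ implies $K\subseteq U$ for some $K\in\mathcal K$. $X$ is $\omega$-well-filtered if for every countable filtered family $\{K_i: i<\omega\}\subseteq\mathsf K(X)$ and every open $U$, $\bigcap_{i<\omega}K_i\subseteq U$ implies $K_{i_0}\subseteq U$ for some $i_0<\omega$. A nonempty set $A\subseteq X$ is irreducible if whenever $A\subseteq F_1\cup F_2$ with $F_1,F_2$ closed, then $A\subseteq F_1$ or $A\subseteq F_2$. $X$ is sober if every irreducible closed subset is $\overline{\{a\}}$ for a unique $a\in X$. A $T_0$ space $X$ is a $d$-space if every directed subset $D$ of $X$ has a supremum, and for every open $U$, $\bigvee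 D\in U$ implies $D\cap U\neq\emptyset$. A nonempty subset $D$ of a poset is countably-directed if every nonempty countable subset of $D$ has an upper bound in $D$. $X$ is an $\omega^\ast$-$d$-space if every countably-directed subset $D$ of $X$ has a supremum, and for every open $U$, $\bigvee D\in U$ implies $D\cap U\ne\emptyset$. *)

(* Defs.v *)
From mathcomp Require Import all_boot.
From mathcomp Require Import all_classical topology.

Set Implicit Arguments.
Unset Strict Implicit.
Unset Printing Implicit Defensive.

Local Open Scope classical_set_scope.

Definition first_countable (T : topologicalType) : Prop :=
  forall x : T, exists2 B : set (set T),
    countable B & B `<=` nbhs x /\
      forall U, nbhs x U -> exists2 V, B V & V `<=` U.

(* The specialization order is kept as a plain relation: it is antisymmetric
   only on T0 spaces, and T may already carry another canonical order. *)
Definition spec_le (T : topologicalType) (x y : T) : Prop :=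
  closure [set y] x.

Definition spec_ubound (T : topologicalType) (D : set T) : set T :=
  [set u | forall x, D x -> spec_le x u].

Definition spec_supremum (T : topologicalType) (D : set T) (s : T) : Prop :=
  spec_ubound D s /\ forall u, spec_ubound D u -> spec_le s u.

Definition saturated (T : topologicalType) (A : set T) : Prop :=
  forall x y, A x -> spec_le x y -> A y.

Definition compact_saturated (T : topologicalType) : set (set T) :=
  [set K | [/\ K !=set0, compact K & saturated K]].

Definition filtered_family (T : Type) (F : set (set T)) : Prop :=
  F !=set0 /\
  forall K1 K2, F K1 -> F K2 -> exists2 K3, F K3 & K3 `<=` K1 `&` K2.

Definition well_filtered (T : topologicalType) : Prop :=
  forall (U : set T) (F : set (set T)),
    open U -> F `<=` @compact_saturated T -> filtered_family F ->
    \bigcap_(K in F) K `<=` U -> exists2 K, F K & K `<=` U.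

Definition omega_well_filtered (T : topologicalType) : Prop :=
  forall (U : set T) (K : nat -> set T),
    open U -> range K `<=` @compact_saturated T -> filtered_family (range K) ->
    \bigcap_i K i `<=` U -> exists i, K i `<=` U.

Definition irreducible_set (T : topologicalType) (A : set T) : Prop :=
  A !=set0 /\
  forall F1 F2 : set T, closed F1 -> closed F2 ->
    A `<=` F1 `|` F2 -> A `<=` F1 \/ A `<=` F2.

Definition sober (T : topologicalType) : Prop :=
  forall A : set T, irreducible_set A -> closed A ->
    exists! a, A = closure [set a].

Definition directed (T : topologicalType) (D : set T) : Prop :=
  D !=set0 /\
  forall x y, D x -> D y -> exists2 z, D z & spec_le x z /\ spec_le y z.

(* [countable] includes finite sets. *)
Definition countably_directed (T : topologicalType) (D : set T) : Prop :=
  D !=set0 /\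
  forall C : set T, C !=set0 -> countable C -> C `<=` D ->
    exists2 u, D u & spec_ubound C u.

(* Quantifying over every supremum s is harmless: on a T0 space, suprema are
   unique. *)
Definition sup_inaccessible (T : topologicalType) (D : set T) : Prop :=
  (exists s, spec_supremum D s) /\
  forall s U, spec_supremum D s -> open U -> U s -> D `&` U !=set0.

Definition d_space (T : topologicalType) : Prop :=
  forall D : set T, directed D -> sup_inaccessible D.

Definition omega_star_d_space (T : topologicalType) : Prop :=
  forall D : set T, countably_directed D -> sup_inaccessible D.

(* Main.v *)
(* The step back to sobriety rests on this: in a first-countable space, given
   points x_0, x_1, ... of an irreducible closed set A, one can choose in A a
   sequence converging to every x_i and to each of its own terms. The upper
   closures of its tails are then compact, so omega-well-filteredness yields a
   point of A in all of them; it is an upper bound of the x_i. Thus A is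
   countably directed, and its supremum is its generic point. *)
Require Import Defs.
From mathcomp Require Import all_boot.
From mathcomp Require Import all_classical topology.

Set Implicit Arguments.
Unset Strict Implicit.
Unset Printing Implicit Defensive.

Local Open Scope classical_set_scope.

(** * Upper bounds and suprema in the specialization order *)

Section SpecializationOrder.
Variable X : topologicalType.
Implicit Types (x y z : X) (A D U : set X).

Lemma spec_le_refl x : spec_le x x.
Proof. exact: subset_closure. Qed.

Lemma spec_le_nbhs x y U : spec_le x y -> nbhs x U -> U y.
Proof. by move=> xy /xy[_ [->]]. Qed.

Lemma spec_le_trans y x z : spec_le x y -> spec_le y z -> spec_le x z.
Proof.
move=> xy yz B /nbhs_interior Bx; exists z; split => //.
exact: spec_le_nbhs yz (spec_le_nbhs xy Bx).
Qed.

Lemma spec_le_closed A x y : closed A -> spec_le x y -> A y -> A x.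
Proof. by move=> cA xy Ay; apply: cA => B /(spec_le_nbhs xy) By; exists y. Qed.

Lemma spec_le_anti x y :
  kolmogorov_space X -> spec_le x y -> spec_le y x -> x = y.
Proof.
move=> T0 xy yx; apply/eqP/negPn/negP => /T0[B].
by case=> -[]; rewrite !inE => ? [];
  [exact: (spec_le_nbhs xy)|exact: (spec_le_nbhs yx)].
Qed.

(** Closed sets are lower sets, so a greatest element is a generic point. *)
Lemma closed_closure_ubound A s :
  closed A -> A s -> spec_ubound A s -> A = closure [set s].
Proof.
move=> cA As ubs; apply/seteqP; split => [x /ubs//|x xs].
exact: spec_le_closed cA xs As.
Qed.

(** If [u] bounds [D], the closed set [closure [set u]] contains [D], hence also [s]; so [s] is a
    least upper bound. *)
Lemma closure_ubound_inaccessible D s :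
  closure D s -> spec_ubound D s -> sup_inaccessible D.
Proof.
move=> Ds ubs.
have lub : spec_supremum D s.
  split=> // u ubu; apply: closed_closure => B /nbhs_interior Bs.
  have [e [De Be]] := Ds _ Bs; exists e; split; first exact: ubu.
  exact: interior_subset Be.
split; first by exists s.
move=> t U [_ tmin] oU Ut; apply: Ds.
have Us : U s by apply: spec_le_nbhs (tmin _ ubs) _; exact: open_nbhs_nbhs.
exact: open_nbhs_nbhs.
Qed.

End SpecializationOrder.

(** * Compactness along chains of open sets and convergent sequences *)

Section Compactness.
Variable X : topologicalType.

(** The filter [F] of final segments of the chain gives a near covering: each point of [K] has a
    neighborhood inside all large enough members. *)
Lemma compact_open_chain (K : set X) (C : set (set X)) :
  compact K -> C !=set0 -> C `<=` open -> total_on C subset ->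
  K `<=` \bigcup_(W in C) W -> exists2 W, C W & K `<=` W.
Proof.
move=> /compact_near_coveringP cK C0 oC tC KC.
pose F := filter_from C (fun W => [set W' | C W' /\ W `<=` W']).
have FF : Filter F.
  apply: filter_from_filter => // W1 W2 C1 C2.
  by have [W12|W21] := tC _ _ C1 C2;
    [exists W2 => // W [CW sW]|exists W1 => // W [CW sW]];
    split; split=> //; exact: subset_trans sW.
have [x /KC[W CW Wx]|W CW] := cK _ F (fun W x => W x) FF; last first.
  by move=> /(_ W (conj CW (@subset_refl _ W))) KW; exists W.
exists (W, [set W' | C W' /\ W `<=` W']).
  by split; [exact: open_nbhs_nbhs (conj (oC _ CW) Wx)|exists W].
by move=> [z W'] /= [Wz [_]]; exact.
Qed.

(* Each term being a limit of the sequence, a neighborhood of the first term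
   already contains all but finitely many of the others. *)
Lemma compact_saturated_tail (y : nat -> X) n :
  (forall m, y @ \oo --> y m) ->
  compact_saturated [set z | exists2 m, n <= m & spec_le (y m) z].
Proof.
move=> ylim; split.
- by exists (y n), n => //; exact: spec_le_refl.
- apply/compact_near_coveringP => I F P FF cov.
  have term m : n <= m ->
      exists2 V, nbhs (y m) V & \forall i \near F, V `<=` P i.
    move=> nm; have [|[V E] [/= Vm FE] VE] := cov (y m).
      by exists m => //; exact: spec_le_refl.
    by exists V => //; apply: filterS FE => i Ei z Vz; exact: (VE (z, i)).
  have [V /nbhs_interior Vn FV] := term n (leqnn n).
  have [M _ yV] := ylim n _ Vn.
  (* The finitely many terms before [k] are handled one at a time; a neighborhood of a term contains
     all points above it. *)
  have initial k : \forall i \near F, forall m z,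
      n <= m -> m < k -> spec_le (y m) z -> P i z.
    elim: k => [|k IH]; first exact: nearW.
    have [nk|kn] := leqP n k; last first.
      apply: filterS IH => i Pi m z nm; rewrite ltnS leq_eqVlt => /orP[/eqP mk|].
        by move: kn; rewrite -mk ltnNge nm.
      exact: Pi.
    have [W Wk FW] := term k nk.
    apply: filterS2 IH FW => i Pi WP m z nm.
    rewrite ltnS leq_eqVlt => /orP[/eqP -> kz|]; last exact: Pi.
    by apply: WP; exact: spec_le_nbhs kz Wk.
  apply: filterS2 FV (initial M) => i VP Pi z [m nm mz].
  have [Mm|mM] := leqP M m; last exact: Pi mz.
  by apply: VP; apply: spec_le_nbhs mz _; exact: yV.
- by move=> u v [m nm mu] uv; exists m => //; exact: spec_le_trans uv.
Qed.

Lemma compact_saturated_up (x : X) : compact_saturated [set z | spec_le x z].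
Proof.
have -> : [set z | spec_le x z] = [set z | exists2 m, 0 <= m & spec_le x z].
  by apply/seteqP; split=> z; [exists 0|case].
by apply: (@compact_saturated_tail (fun=> x)) => _; exact: cvg_cst.
Qed.

End Compactness.

(** * Irreducible sets and sequences in first-countable spaces *)

Lemma irreducible_set_meet (X : topologicalType) (A U V : set X) :
  irreducible_set A -> open U -> open V ->
  A `&` U !=set0 -> A `&` V !=set0 -> A `&` (U `&` V) !=set0.
Proof.
move=> [_ irrA] oU oV [u [Au Uu]] [v [Av Vv]]; apply: contrapT => AUV0.
have [x Ax|/(_ u Au)//|/(_ v Av)//] :=
  irrA (~` U) (~` V) (open_closedC oU) (open_closedC oV).
by rewrite -setCI => UVx; apply: AUV0; exists x.
Qed.

Lemma irreducible_set_nbhs_meet (X : topologicalType) (A : set X)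
    (W : X -> set X) (s : seq X) :
  irreducible_set A -> (forall p, p \in s -> A p) ->
  (forall p, p \in s -> nbhs p (W p)) ->
  exists2 z, A z & forall p, p \in s -> W p z.
Proof.
move=> irrA sA sW.
(* An open set meeting [A], unlike a single point, can be shrunk further in the induction. *)
suff [V [oV [z [Az Vz]] VW]] : exists V, [/\ open V, A `&` V !=set0 &
    forall p, p \in s -> V `<=` W p].
  by exists z => // p /VW; exact.
elim: s sA sW => [_ _|p s IH sA sW].
  have [[a Aa] _] := irrA.
  by exists setT; split=> //; [exact: openT|exists a].
have [q qs|q qs|V [oV AV VW]] := IH.
- by apply: sA; rewrite inE qs orbT.
- by apply: sW; rewrite inE qs orbT.
exists (V `&` (W p)^°); split.
- by apply: openI => //; exact: open_interior.
- apply: irreducible_set_meet => //; first exact: open_interior.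
  exists p; split; first by apply: sA; rewrite mem_head.
  by apply: sW; rewrite mem_head.
- move=> q; rewrite inE => /orP[/eqP -> z [_ /interior_subset]//|qs z [Vz _]].
  exact: VW qs _ Vz.
Qed.

Lemma countable_range (T : Type) (C : set T) :
  C !=set0 -> countable C -> exists e : nat -> T, C = range e.
Proof.
move=> [c Cc] /pfcard_geP[C0|[e]]; first by rewrite C0 in Cc.
by exists e; rewrite image_eq.
Qed.

Lemma first_countable_seq (X : topologicalType) (x : X) : first_countable X ->
  exists N : nat -> set X, [/\ forall n, nbhs x (N n),
    forall m n, m <= n -> N n `<=` N m &
    forall U, nbhs x U -> exists n, N n `<=` U].
Proof.
move=> /(_ x)[B cB [Bx Bbase]].
have B0 : B !=set0 by have [V BV _] := Bbase setT filterT; exists V.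
have [e Be] := countable_range B0 cB.
(* Intersecting initial segments of the enumerated base makes it decreasing. *)
exists (fun n => [set z | forall k, k <= n -> e k z]); split.
- move=> n.
  suff : nbhs x [set z | forall k, k < n.+1 -> e k z] by [].
  elim: n.+1 => [|m IH]; first exact: nearW.
  have em : nbhs x (e m) by apply: Bx; rewrite Be; exists m.
  apply: filterS2 IH em => z ez emz k.
  by rewrite ltnS leq_eqVlt => /orP[/eqP ->|/ez].
- by move=> m n mn z ez k km; apply: ez; exact: leq_trans mn.
- move=> U /Bbase[V]; rewrite Be => -[n _ <-] nU.
  by exists n => z /(_ n (leqnn n)); exact: nU.
Qed.

(* The n-th term is taken in the n-th neighborhoods of all the [x i] and of
   all the earlier terms, so that every term is a limit as well. *)
Lemma irreducible_cluster_seq (X : topologicalType) (A : set X)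
    (x : nat -> X) :
  first_countable X -> irreducible_set A -> range x `<=` A ->
  exists y : nat -> X, [/\ range y `<=` A, forall m, y @ \oo --> y m &
    forall i, y @ \oo --> x i].
Proof.
move=> fcX irrA xA.
have [N NP] := choice (fun p : X => first_countable_seq p fcX).
(* On lists not contained in [A] the condition on [f] is void, and [x 0] is an arbitrary witness. *)
have /choice[f fP] (s : seq X) : exists z, (forall p, p \in s -> A p) ->
    A z /\ forall p, p \in s -> N p (size s) z.
  have [sA|nsA] := pselect (forall p, p \in s -> A p); last first.
    by exists (x 0) => /nsA.
  have [p ps|z Az zN] :=
      irreducible_set_nbhs_meet (W := fun p => N p (size s)) irrA sA.
    by case: (NP p).
  by exists z.
(* [L n] collects [x i] and the chosen terms [f (L i)] for [i < n]; the next term is [f (L n)]. *)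
pose L := fix L n := if n is m.+1 then f (L m) :: x m :: L m else [::].
have LA n p : p \in L n -> A p.
  elim: n p => //= n IH p; rewrite !inE => /or3P[/eqP ->|/eqP ->|/IH//].
    by case: (fP (L n) IH).
  by apply: xA; exists n.
have sizeL n : n <= size (L n).
  by elim: n => //= n IH; rewrite ltnS leqW.
have subL m n p : m <= n -> p \in L m -> p \in L n.
  move=> /subnK <-; elim: (n - m) => //= k IH /IH.
  by rewrite !inE => ->; rewrite !orbT.
have lim m p : p \in L m -> (f \o L) @ \oo --> p.
  move=> pLm U pU; have [_ Ndec Nbase] := NP p; have [k NkU] := Nbase _ pU.
  exists (maxn m k) => // n /=; rewrite geq_max => /andP[mn kn].
  have [_ /(_ p (subL _ _ _ mn pLm)) Np] := fP (L n) (LA n).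
  by apply: NkU; apply: Ndec Np; exact: leq_trans (sizeL n).
exists (f \o L); split.
- by move=> _ [n _ <-]; case: (fP (L n) (LA n)).
- by move=> m; apply: (lim m.+1); rewrite /= mem_head.
- by move=> i; apply: (lim i.+1); rewrite /= !inE eqxx orbT.
Qed.

(** * From irreducible closed sets to generic points *)

Lemma irreducible_countably_directed (X : topologicalType) (A : set X) :
  first_countable X -> omega_well_filtered X ->
  irreducible_set A -> closed A -> countably_directed A.
Proof.
move=> fcX wfX irrA cA; split; first by case: irrA.
move=> C C0 cC CA; have [x Cx] := countable_range C0 cC.
rewrite {}Cx in CA *.
have [y [yA yy yx]] := irreducible_cluster_seq fcX irrA CA.
pose K n := [set z | exists2 m, n <= m & spec_le (y m) z].
(* Otherwise the complement of [A] contains the intersection of the [K n], hence some [K i],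
   although [y i] lies in [A] and in [K i]. *)
have [z [Az Kz]] : exists z, A z /\ forall n, K n z.
  apply: contrapT => noz.
  have [||||i /(_ (y i))] := wfX (~` A) K.
  - exact: closed_openC.
  - by move=> _ [n _ <-]; exact: compact_saturated_tail.
  - split; first by exists (K 0), 0.
    move=> _ _ [m _ <-] [n _ <-]; exists (K (maxn m n)); first by exists (maxn m n).
    by move=> z [k]; rewrite geq_max => /andP[mk nk] kz; split; exists k.
  - by move=> z Kz Az; apply: noz; exists z; split=> // n; exact: Kz.
  - by apply; [exists i => //; exact: spec_le_refl|apply: yA; exists i].
exists z => // _ [i _ <-] V /nbhs_interior xV; exists z; split=> //.
have [M _ yV] := yx i _ xV; have [m Mm mz] := Kz M.
by apply: spec_le_nbhs mz _; exact: yV.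
Qed.

Lemma omega_star_d_space_sober (X : topologicalType) :
  kolmogorov_space X -> first_countable X ->
  omega_well_filtered X -> omega_star_d_space X -> sober X.
Proof.
move=> T0 fcX wfX dX A irrA cA.
have [[s ubs] inacc] := dX A (irreducible_countably_directed fcX wfX irrA cA).
(* Otherwise the open complement of [A] contains the supremum, so it meets [A]. *)
have As : A s.
  apply: contrapT => nAs.
  by have [z []] := inacc s (~` A) ubs (closed_openC cA) nAs.
have Acl := closed_closure_ubound cA As (proj1 ubs).
exists s; split=> // t At.
have ss := @spec_le_refl _ s; have tt := @spec_le_refl _ t.
by apply: spec_le_anti => //; rewrite /spec_le -?At -?Acl // At.
Qed.

(** * From sober to well-filtered spaces *)

(* Topological Rudin lemma: a closed set minimal among those meeting all
   members of a filtered family of compact sets is irreducible. *)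
Lemma filtered_compact_irreducible (X : topologicalType)
    (F : set (set X)) (U : set X) :
  open U -> F `<=` compact -> filtered_family F ->
  (forall K, F K -> ~ K `<=` U) ->
  exists A, [/\ irreducible_set A, closed A, A `<=` ~` U &
    forall K, F K -> K `&` A !=set0].
Proof.
move=> oU cF [[K0 FK0] fF] FU.
(* Zorn's lemma is applied to complements: the closed set avoiding [U] is minimal when the open set
   [W] is maximal. *)
pose P := [set W : set X | open W /\ forall K, F K -> ~ K `<=` U `|` W].
have [C CP tC|W [[oW FW] Wmax]] := @Zorn_bigcup _ P.
  split; first by apply: bigcup_open => W /CP[].
  move=> K FK KU; have [C0|C0] := eqVneq C set0.
    by apply: (FU K FK); rewrite C0 bigcup_set0 setU0 in KU.
  have [c Cc] : C !=set0 by exact/set0P.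
  have [||||_ [W CW <-]] :=
    @compact_open_chain _ K [set U `|` W | W in C] (cF _ FK).
  - by exists (U `|` c), c.
  - by move=> _ [W CW <-]; apply: openU => //; case: (CP _ CW).
  - move=> _ _ [V CV <-] [W CW <-].
    by have [VW|WV] := tC _ _ CV CW; [left|right]; exact: setUS.
  - move=> z /KU[Uz|[W CW Wz]].
      by exists (U `|` c); [exists c|left].
    by exists (U `|` W); [exists W|right].
  - by case: (CP _ CW) => _ /(_ _ FK).
have ext V : open V -> ~ V `<=` U `|` W ->
    exists2 K, F K & K `<=` U `|` (W `|` V).
  move=> oV nVW; apply: contrapT => noK; apply: (Wmax (W `|` V)).
    by split=> [|WV]; [left|apply: nVW => z Vz; right; apply: WV; right].
  by split; [exact: openU|move=> K FK KV; apply: noK; exists K].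
exists (~` (U `|` W)); split.
- split.
    apply: contrapT => W0; apply: (FW _ FK0) => z _; apply: contrapT => nz.
    by apply: W0; exists z.
  (* By maximality, adding either complement to [W] swallows a member of [F]; a member inside both
     would then lie in the union of [U] and [W]. *)
  move=> F1 F2 cF1 cF2 sub; apply: contrapT => /not_orP[n1 n2].
  have [|K1 FK1 sK1] := ext (~` F1) (closed_openC cF1).
    by move=> s; apply: n1; rewrite -[F1]setCK; exact: subsetC.
  have [|K2 FK2 sK2] := ext (~` F2) (closed_openC cF2).
    by move=> s; apply: n2; rewrite -[F2]setCK; exact: subsetC.
  have [K3 FK3 sK3] := fF _ _ FK1 FK2.
  apply: (FW _ FK3) => z /sK3[/sK1 z1 /sK2 z2]; apply: contrapT => nz.
  case: (sub z nz) => Fz.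
    by case: z1 => [|[|]] // ?; apply: nz; [left|right].
  by case: z2 => [|[|]] // ?; apply: nz; [left|right].
- by apply: open_closedC; exact: openU.
- by move=> z nz Uz; apply: nz; left.
- move=> K FK; apply: contrapT => nK; apply: (FW _ FK) => z Kz.
  by apply: contrapT => nz; apply: nK; exists z.
Qed.

(** Each [K] meets the irreducible set [A] below its generic point [a], so by saturation it contains
    [a]; this puts [a] in [U], which [A] avoids. *)
Lemma sober_well_filtered (X : topologicalType) : sober X -> well_filtered X.
Proof.
move=> sX U F oU FK fF FU; apply: contrapT => noK.
have [|K FK' KU|A [irrA cA AU AF]] := @filtered_compact_irreducible X F U oU _ fF.
- by move=> K /FK[].
- by apply: noK; exists K.
have [a [Aa _]] := sX A irrA cA.
apply: (AU a); first by rewrite Aa; exact: spec_le_refl.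
apply: FU => K FK'; have [z [Kz Az]] := AF K FK'; have [_ _ satK] := FK _ FK'.
by apply: satK Kz _; rewrite Aa in Az.
Qed.

(** * From well-filtered spaces to d-spaces, and the cycle of implications *)

Lemma well_filtered_omega (X : topologicalType) :
  well_filtered X -> omega_well_filtered X.
Proof.
move=> wfX U K oU KK fK KU.
have [|_ [i _ <-] KiU] := wfX U (range K) oU KK fK; last by exists i.
by rewrite bigcap_image.
Qed.

(** The principal upper sets of points of [D] form a filtered family whose intersection is the set
    of upper bounds. If it missed [closure D], so would one of them, yet each contains its own point
    of [D]. *)
Lemma well_filtered_d_space (X : topologicalType) :
  well_filtered X -> d_space X.
Proof.
move=> wfX D [[d Dd] dirD].
have [s [Ds ubs]] : exists s, closure D s /\ spec_ubound D s.
  apply: contrapT => nos.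
  have [||||_ [e De <-] /(_ e (@spec_le_refl _ e))] :=
    wfX (~` closure D) [set [set z | spec_le e z] | e in D].
  - by apply: closed_openC; exact: closed_closure.
  - by move=> _ [e _ <-]; exact: compact_saturated_up.
  - split; first by exists [set z | spec_le d z], d.
    move=> _ _ [e1 De1 <-] [e2 De2 <-]; have [e De [e1e e2e]] := dirD _ _ De1 De2.
    exists [set z | spec_le e z]; first by exists e.
    by move=> z ez; split; exact: spec_le_trans ez.
  - move=> z ubz clz; apply: nos; exists z; split=> // e De.
    by apply: (ubz [set z | spec_le e z]); exists e.
  - by apply; exact: subset_closure.
exact: closure_ubound_inaccessible Ds ubs.
Qed.

Lemma countably_directed_directed (X : topologicalType) (D : set X) :
  countably_directed D -> directed D.
Proof.
move=> [D0 cdD]; split=> // x y Dx Dy.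
have [|||u Du ubu] := cdD [set x; y].
- by exists x; left.
- by apply: finite_set_countable; exact: finite_set2.
- by move=> _ [->|->].
by exists u => //; split; apply: ubu; [left|right].
Qed.

Theorem theorem7p3 (X : topologicalType)
    (X_T0 : kolmogorov_space X) (X_fc : first_countable X) :
  [<-> sober X;
       well_filtered X;
       omega_well_filtered X /\ d_space X;
       omega_well_filtered X /\ omega_star_d_space X].
Proof.
tfae.
- exact: sober_well_filtered.
- by move=> wfX; split; [exact: well_filtered_omega|exact: well_filtered_d_space].
- move=> [wfX dX]; split=> // D /countably_directed_directed; exact: dX.
- by case; exact: omega_star_d_space_sober.
Qed.
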